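(* Let $M$ be a positive integer, and for $1\le k\le K$ and $t\ge-L_k$ let $\mathbb Y^k(t)$ be the $\mathbf y^k$-component of the (unique) optimal solution of the linear program $\mathrm{LP}^k_M$ with inputs $$\mathbf y^{k'}=\mathbb Y^{k'}(t+L_k-L_{k'})\ (k<k'\le K)\quad\text{and}\quad\mathbf x=\mathbf D(t+L_k-L_K,t).$$ Then there is a constant $\kappa$, depending only on $(m,n_1,\dots,n_K)$ and $A^k$ ($1\le k\le K$), such that on each sample path, for all $1\le j\le n$ and all $t_2>t_1\ge-L_{k_j}$, $$|\mathbb Y_j(t_2)-\mathbb Y_j(t_1)|\le\kappa\sum_{k>k_j}\big\|\mathbf D(t_2-(L_k-L_{k_j}),t_2)-\mathbf D(t_1-(L_k-L_{k_j}),t_1)\big\|_1.$$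
   Context: There are $m$ products and $n$ components. $A$ is an $n\times m$ non-negative integer matrix with at least one non-zero entry in every row and every column. Lead times are $0=L_0<L_1<\dots<L_K$. The components are partitioned into $K$ consecutive groups of sizes $n_1,\dots,n_K$ with $\sum_kn_k=n$, group $k$ having lead time $L_k$; $k_j$ is the group of component $j$; $A^k$ is the $n_k\times m$ submatrix of $A$ formed by the rows of group $k$. $\mathbf h\in\mathbb R^n$, $\mathbf b\in\mathbb R^m$ have strictly positive entries, $\mathbf h^k$ is the part of $\mathbf h$ for group $k$, $\mathbf c=\mathbf b+\sum_k(A^k)'\mathbf h^k$. Demand $\mathcal D(t)$, $t\ge-L_K$, is an $m$-dimensional right-continuous compound Poisson process with non-negative integer-valued i.i.d. order-size vectors; $\mathbf D(t_1,t_2)=\mathcal D(t_2)-\mathcal D(t_1)$. $\mathbb Y_j(t)$ is the entry of $\mathbb Y^{k_j}(t)$ for component $j$. For $k=K$ the input is $\mathbf x=\mathbf 0$ and there are no $\mathbf y^{k'}$, so $\mathbb Y^K$ is constant. $\mathbf D^1,\dots,\mathbf D^K$ are independent, $\mathbf D^k$ distributed as $\mathcal D(t-L_{k-1})-\mathcal D(t-L_k)$. $\mathbf D^k_M=\mathbf D^k\wedge\mathbf M$ (componentwise minimum; $\mathbf M$ the vector with all entries $M$), which has finite support. **Scenario strings.** For $0\le k'<k\le K$, $\Omega_k^{k'}$ is the set of strings $\bar\omega=\omega^k\cdots\omega^{k'+1}$ encoding realizations of $(\mathbf D^k_M,\dots,\mathbf D^{k'+1}_M)$, with probability $\mathbb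 P(\bar\omega)=\prod_{l=k'+1}^k\Pr\{\mathbf D^l_M=\mathbf D^l_M(\omega^l)\}$. $\bar\omega'\sqsubset\bar\omega$ means $\bar\omega'$ is a prefix of $\bar\omega$. For $\bar\omega\in\Omega_k^0$, $\underline{\mathbf D}^k_M(\bar\omega)=\mathbf D^k_M(\omega^k)+\dots+\mathbf D^1_M(\omega^1)$. **$\mathrm{LP}^k_M$ with inputs $(\mathbf y^{k+1},\dots,\mathbf y^K,\mathbf x)$.** Variables $\mathbf y^k\in\mathbb R^{n_k}$, $\mathbf y^{k'}(\bar\omega')\in\mathbb R^{n_{k'}}$ ($1\le k'<k$, $\bar\omega'\in\Omega_k^{k'}$), $\mathbf z(\bar\omega)\in\mathbb R^m$ ($\bar\omega\in\Omega_k^0$). Minimize $$\mathbf h^k\cdot\mathbf y^k+\sum_{k'=1}^{k-1}\sum_{\bar\omega\in\Omega_k^{k'}}\mathbb P(\bar\omega)\mathbf h^{k'}\cdot\mathbf y^{k'}(\bar\omega)-\sum_{\bar\omega\in\Omega_k^0}\mathbb P(\bar\omega)\mathbf c\cdot\mathbf z(\bar\omega)$$ subject to - $\mathbf z(\bar\omega)\le\mathbf x+\underline{\mathbf D}^k_M(\bar\omega)$, $\bar\omega\in\Omega_k^0$; - $A^{k'}\mathbf z(\bar\omega)-\mathbf y^{k'}(\bar\omega')\le\mathbf 0$, $\bar\omega\in\Omega_k^0$, $\bar\omega'\in\Omega_k^{k'}$, $\bar\omega'\sqsubset\bar\omega$, $1\le k'<k$; - $A^k\mathbf z(\bar\omega)-\mathbf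 y^k\le\mathbf 0$, $\bar\omega\in\Omega_k^0$; - $A^{k'}\mathbf z(\bar\omega)\le\mathbf y^{k'}$, $\bar\omega\in\Omega_k^0$, $k<k'\le K$. The objective coefficients ($\mathbb P(\bar\omega)$, $\mathbf h^{k'}$, $\mathbf c$) are understood to be slightly perturbed, with the same perturbed values used for all inputs, so that the optimal solutions considered are unique. *)

(* Defs.v *)
From HB Require Import structures.
From mathcomp Require Import all_boot all_order all_algebra.
From mathcomp Require Import all_classical all_reals all_analysis.

Set Implicit Arguments.
Unset Strict Implicit.
Unset Printing Implicit Defensive.

Import Order.TTheory GRing.Theory Num.Theory.
Import numFieldNormedType.Exports.

Local Open Scope classical_set_scope.
Local Open Scope ring_scope.

(* Conventions.  The group k = 1, ..., K is represented by g : 'I_K with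
   k = g.+1, whereas the functions of a level (lead times L, laws p of the
   truncated lead-time demands, sets Omega of scenario strings) take the
   1-based number k itself.  Vectors are columns; componentwise order. *)

Definition dotp {R : realType} {n : nat} (u v : 'cV[R]_n) : R :=
  \sum_i u i 0 * v i 0.

Definition lev {R : realType} {n : nat} (u v : 'cV[R]_n) : Prop :=
  forall i, u i 0 <= v i 0.

Definition norm1 {R : realType} {n : nat} (u : 'cV[R]_n) : R :=
  \sum_i `|u i 0|.

(** Compound Poisson demand *)

(* The process starts at time t0 with value 0.  N is the counting process of
   the orders and S i the size vector of the i-th order.  All variables being
   discrete, the product formula for the joint law says at once that N has
   independent Poisson increments, that the S i are i.i.d., and that the
   sequence S is independent of N. *)
Definition compound_poisson {R : realType} {d : measure_display}
    {T : measurableType d} (P : probability T R) (t0 : R) (m : nat)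
    (D : R -> T -> 'cV[nat]_m) : Prop :=
  exists (rate : R) (N : R -> T -> nat) (S : nat -> T -> 'cV[nat]_m),
  [/\ 0 < rate,
      (forall t a, t0 <= t -> measurable [set w | N t w = a]) /\
      (forall i v, measurable [set w | S i w = v]),
      forall w,
        [/\ N t0 w = 0%N,
            forall s t, t0 <= s -> s <= t -> (N s w <= N t w)%N &
            forall t, t0 <= t -> \forall s \near t^'+, N s w = N t w],
      forall (r q : nat) (s : nat -> R) (a : nat -> nat) (v : nat -> 'cV[nat]_m),
        t0 <= s 0%N ->
        (forall i, (i < r)%N -> s i < s i.+1) ->
        P [set w | (forall i, (i < r)%N -> N (s i.+1) w = (N (s i) w + a i)%N) /\
                   (forall i, (i < q)%N -> S i w = v i)] =
        ((\prod_(i < r) poisson_pmf (rate * (s i.+1 - s i)) (a i)) *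
         \prod_(i < q) fine (P [set w | S 0%N w = v i]))%:E &
      forall t w, t0 <= t -> D t w = \sum_(i < N t w) S i w].

Definition demand {R : realType} {T : Type} {m : nat}
    (D : R -> T -> 'cV[nat]_m) (w : T) (t1 t2 : R) : 'cV[R]_m :=
  \col_i ((D t2 w i 0)%:R - (D t1 w i 0)%:R).

(** Scenario strings *)

(* A letter is a possible value of a demand vector truncated at M. *)
Notation letter m M := {ffun 'I_m -> 'I_M.+1}.

(* Pr {D^l_M = v}, with D^l distributed as D(t - L_l, t - L_(l-1)).  The
   increments are stationary, so the law is read off at t = 0. *)
Definition trunc_law {R : realType} {d : measure_display}
    {T : measurableType d} (P : probability T R) (m : nat)
    (D : R -> T -> 'cV[nat]_m) (L : nat -> R) (M l : nat) (v : letter m M) : R :=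
  fine (P [set w | forall i,
    Num.min (demand D w (- L l) (- L l.-1) i 0) M%:R = (v i)%:R]).

(* Strings omega^k ... omega^(k'+1): the letter at position i (from 0) is
   omega^(k-i). *)
Notation scenario m M k k' := ((k - k').-tuple (letter m M)).

Definition Omega {R : realType} {m M : nat} (p : nat -> letter m M -> R)
    (k k' : nat) : {set scenario m M k k'} :=
  finset (fun s : scenario m M k k' =>
    [forall i : 'I_(k - k'), 0 < p (k - i)%N (tnth s i)]).

Definition scenario_prob {R : realType} {m M : nat}
    (p : nat -> letter m M -> R) (k k' : nat) (s : scenario m M k k') : R :=
  \prod_(i < k - k') p (k - i)%N (tnth s i).

Definition scenario_demand {R : realType} {m M k : nat}
    (s : scenario m M k 0) : 'cV[R]_m :=
  \col_i \sum_(l < k - 0) (tnth s l i)%:R.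

(** The linear programs *)

Definition submx_group {R : realType} {m K : nat} {n_ : 'I_K -> nat}
    (A : 'M[nat]_(\sum_g n_ g, m)) (g : 'I_K) : 'M[R]_(n_ g, m) :=
  map_mx (fun a => a%:R) (submxcol A g).

Definition cost_c {R : realType} {m K : nat} {n_ : 'I_K -> nat}
    (A : 'M[nat]_(\sum_g n_ g, m)) (h : 'cV[R]_(\sum_g n_ g)) (b : 'cV[R]_m) :
    'cV[R]_m :=
  b + \sum_g (submx_group A g)^T *m submxcol h g.

(* Only the values of lp_ysc and lp_z on strings of Omega are meaningful. *)
Record lp_point (R : realType) (m M K : nat) (n_ : 'I_K -> nat) (g : 'I_K) :=
  LPPoint {
    lp_y : 'cV[R]_(n_ g);
    lp_ysc : forall g' : 'I_K, scenario m M g.+1 g'.+1 -> 'cV[R]_(n_ g');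
    lp_z : scenario m M g.+1 0 -> 'cV[R]_m }.

Definition lp_feasible {R : realType} {m M K : nat} {n_ : 'I_K -> nat}
    (A : 'M[nat]_(\sum_g n_ g, m)) (p : nat -> letter m M -> R) (g : 'I_K)
    (yin : forall g' : 'I_K, 'cV[R]_(n_ g')) (x : 'cV[R]_m)
    (s : lp_point R m M n_ g) : Prop :=
  [/\ forall o, o \in Omega p g.+1 0 -> lev (lp_z s o) (x + scenario_demand (k := g.+1) o),
      forall (g' : 'I_K) o o', (g' < g)%N ->
        o \in Omega p g.+1 0 -> o' \in Omega p g.+1 g'.+1 -> prefix o' o ->
        lev (submx_group A g' *m lp_z s o - lp_ysc s o') 0,
      forall o, o \in Omega p g.+1 0 ->
        lev (submx_group A g *m lp_z s o - lp_y s) 0 &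
      forall (g' : 'I_K) o, (g < g')%N -> o \in Omega p g.+1 0 ->
        lev (submx_group A g' *m lp_z s o) (yin g')].

Definition lp_objective {R : realType} {m M K : nat} {n_ : 'I_K -> nat}
    (p : nat -> letter m M -> R) (g : 'I_K)
    (prob : forall k k' : nat, scenario m M k k' -> R)
    (h : 'cV[R]_(\sum_g n_ g)) (c : 'cV[R]_m) (s : lp_point R m M n_ g) : R :=
  dotp (submxcol h g) (lp_y s)
  + \sum_(g' < K | (g' < g)%N) \sum_(o in Omega p g.+1 g'.+1)
      prob g.+1 g'.+1 o * dotp (submxcol h g') (lp_ysc s o)
  - \sum_(o in Omega p g.+1 0) prob g.+1 0%N o * dotp c (lp_z s o).

Definition lp_same {R : realType} {m M K : nat} {n_ : 'I_K -> nat}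
    (p : nat -> letter m M -> R) (g : 'I_K) (s s' : lp_point R m M n_ g) : Prop :=
  [/\ lp_y s = lp_y s',
      forall (g' : 'I_K) o, (g' < g)%N -> o \in Omega p g.+1 g'.+1 ->
        lp_ysc s o = lp_ysc s' o &
      forall o, o \in Omega p g.+1 0 -> lp_z s o = lp_z s' o].

Definition lp_optimal {R : realType} {m M K : nat} {n_ : 'I_K -> nat}
    (A : 'M[nat]_(\sum_g n_ g, m)) (p : nat -> letter m M -> R) (g : 'I_K)
    (prob : forall k k' : nat, scenario m M k k' -> R)
    (h : 'cV[R]_(\sum_g n_ g)) (c : 'cV[R]_m)
    (yin : forall g' : 'I_K, 'cV[R]_(n_ g')) (x : 'cV[R]_m)
    (s : lp_point R m M n_ g) : Prop :=
  lp_feasible A p yin x s /\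
  forall s' : lp_point R m M n_ g, lp_feasible A p yin x s' ->
    lp_objective p prob h c s <= lp_objective p prob h c s'.

Definition lp_unique_optimal {R : realType} {m M K : nat} {n_ : 'I_K -> nat}
    (A : 'M[nat]_(\sum_g n_ g, m)) (p : nat -> letter m M -> R) (g : 'I_K)
    (prob : forall k k' : nat, scenario m M k k' -> R)
    (h : 'cV[R]_(\sum_g n_ g)) (c : 'cV[R]_m)
    (yin : forall g' : 'I_K, 'cV[R]_(n_ g')) (x : 'cV[R]_m)
    (s : lp_point R m M n_ g) : Prop :=
  lp_optimal A p prob h c yin x s /\
  forall s' : lp_point R m M n_ g, lp_optimal A p prob h c yin x s' -> lp_same p s s'.

(* The coefficients prob, h', c' differ from the nominal P(omega), h, c by less
   than delta in every entry.  Only the strings of levels 0 <= k' < k <= K in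
   Omega occur in the objectives. *)
Definition perturbation {R : realType} {m M K : nat} {n_ : 'I_K -> nat}
    (p : nat -> letter m M -> R) (h : 'cV[R]_(\sum_g n_ g)) (c : 'cV[R]_m)
    (delta : R) (prob : forall k k' : nat, scenario m M k k' -> R)
    (h' : 'cV[R]_(\sum_g n_ g)) (c' : 'cV[R]_m) : Prop :=
  [/\ forall k k' (o : scenario m M k k'), (k' < k)%N -> (k <= K)%N ->
        o \in Omega p k k' -> `|prob k k' o - scenario_prob (k := k) (k' := k') p o| < delta,
      forall i, `|h' i 0 - h i 0| < delta &
      forall i, `|c' i 0 - c i 0| < delta].

(* Y g t is the y-component of the unique optimal solution of the program of
   group g with the inputs given by the later groups and by the sample path w. *)
Definition is_lp_policy {R : realType} {T : Type} {m M K : nat}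
    {n_ : 'I_K -> nat} (A : 'M[nat]_(\sum_g n_ g, m))
    (p : nat -> letter m M -> R) (L : nat -> R)
    (prob : forall k k' : nat, scenario m M k k' -> R)
    (h : 'cV[R]_(\sum_g n_ g)) (c : 'cV[R]_m)
    (D : R -> T -> 'cV[nat]_m) (w : T)
    (Y : forall g : 'I_K, R -> 'cV[R]_(n_ g)) : Prop :=
  forall (g : 'I_K) (t : R), - L g.+1 <= t ->
  exists2 s : lp_point R m M n_ g,
    lp_unique_optimal A p prob h c
      (fun g' => Y g' (t + L g.+1 - L g'.+1))
      (demand D w (t + L g.+1 - L K) t) s
    & Y g t = lp_y s.

(* Main.v *)
Require Import Defs.
From HB Require Import structures.
From mathcomp Require Import all_boot all_order all_algebra.
From mathcomp Require Import all_classical all_reals all_analysis.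
From mathcomp Require Import ring lra.
Import Order.TTheory GRing.Theory Num.Theory.
Import numFieldNormedType.Exports.
Local Open Scope ring_scope.

Set Implicit Arguments.
Unset Strict Implicit.
Unset Printing Implicit Defensive.

(** The estimate is a deterministic fact about the linear programs, applied to a
    fixed sample path: only the inputs of the programs vary with time.

    The core is that the first-stage part of the unique optimal solution is
    Lipschitz in the inputs with a constant that depends on the matrix and the
    group sizes only, although the number of scenarios is unbounded
    ([unique_optimal_lipschitz]).  Compare the optimal points for two inputs that
    differ by at most Delta.  A direction that can be followed from the first
    point, and backwards from the second one, has objective 0, so by uniqueness
    its first-stage part is 0.  The directions known to have this property are
    those which solve a homogeneous system of signed constraint rows, and the
    difference of the two points solves the same system up to an error Delta.
    Right-hand sides, costs and probabilities have disappeared from this system;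
    what is left are rows with integer entries, each of which involves the
    variables along a single scenario string.

    It remains to see that such a system, if it determines a first-stage
    variable, does so stably and uniformly in the number of scenarios
    ([elimination_bound]).  Fourier-Motzkin elimination from the last stage to
    the first one shows this.  Eliminating a variable combines only rows whose
    remaining variables lie on a common string, so the number of elimination
    steps is the number of coordinates along one string.  Each step enlarges the
    entries and the error by factors that do not depend on the number of rows.
    In the end only the chosen variable is left, bounded from both sides by rows
    with nonzero integer coefficients.

    The inputs of the program of a group are the stocks of the later groups and
    the lead-time demand of the last group.  Induction from the last group
    down to the first one turns the Lipschitz bound for one program into the
    bound in terms of demands ([policy_lipschitz]). *)

(** * Elimination of variables along scenario strings *)

(** One step of Fourier-Motzkin elimination.  Rows with positive coefficient
    bound x from below, rows with negative coefficient bound it from above, and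
    the pairwise hypothesis says that no lower bound exceeds an upper bound, so
    the largest lower bound is a solution; without lower bounds the smallest
    upper bound is one. *)
Lemma solve_one_variable (R : realFieldType) (I : finType) (P : pred I)
    (r a : I -> R) :
  (forall i, P i -> a i = 0 -> 0 <= r i) ->
  (forall i j, P i -> P j -> 0 < a i -> a j < 0 ->
     0 <= a i * r j - a j * r i) ->
  exists x, forall i, P i -> 0 <= r i + a i * x.
Proof.
move=> zero_row pair_row.
case: (pickP [pred i | P i && (0 < a i)]) => [i0 Pi0 | nopos].
  case: (arg_maxP (fun i => - r i / a i) Pi0) => i /andP[Pi ai] imax.
  exists (- r i / a i) => j Pj.
  have [aj|aj|aj] := ltgtP (a j) 0.
  - have := pair_row _ _ Pi Pj ai aj.
    rewrite -(pmulr_rge0 (r j + _) ai) => h.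
    by rewrite (_ : a i * _ = a i * r j - a j * r i) //; field; rewrite gt_eqF.
  - have := imax j; rewrite /= Pj aj => /(_ isT) h.
    have : a j * (- r j / a j) <= a j * (- r i / a i) by rewrite ler_pM2l.
    rewrite mulrCA divff ?gt_eqF // mulr1; lra.
  - by rewrite aj mul0r addr0 zero_row.
case: (pickP [pred i | P i && (a i < 0)]) => [i0 Pi0 | noneg].
  case: (arg_minP (fun i => - r i / a i) Pi0) => i /andP[Pi ai] imin.
  exists (- r i / a i) => j Pj.
  have [aj|aj|aj] := ltgtP (a j) 0.
  - have := imin j; rewrite /= Pj aj => /(_ isT) h.
    have : a j * (- r j / a j) <= a j * (- r i / a i) by rewrite ler_nM2l.
    rewrite mulrCA divff ?lt_eqF // mulr1; lra.
  - by have := nopos j; rewrite /= Pj aj.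
  - by rewrite aj mul0r addr0 zero_row.
exists 0 => j Pj; rewrite mulr0 addr0 zero_row //.
have := nopos j; have := noneg j; rewrite /= Pj /=.
by case: ltgtP.
Qed.

Section Elimination.
Variables (R : archiRealFieldType) (Q : eqType) (len : Q -> nat).

(** Coordinate q of a decision may depend on the first [len q] letters of the
    scenario string only.  All coordinates are indexed by full strings, which
    replaces the scenario tree by this measurability condition. *)
Definition nonanticipative (n : nat) (T : Type) (d : n.-tuple T -> Q -> R) :=
  forall q (o o' : n.-tuple T),
    take (len q) o = take (len q) o' -> d o q = d o' q.

(** A row has a coefficient for the scalar v, whose size is to be bounded, and
    one for each coordinate that is still to be eliminated. *)
Definition form_val (s : seq Q) (a0 : R) (a : Q -> R) (v : R) (d : Q -> R) : R :=
  a0 * v + \sum_(q <- s) a q * d q.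

Definition int_bounded (B x : R) := x \is a Num.int /\ `|x| <= B.

(** The coefficients produced by cross-multiplying two rows: integrality and a
    bound that does not depend on the number of rows both survive. *)
Lemma int_bounded_cross B x y z t : 1 <= B -> int_bounded B x ->
  int_bounded B y -> int_bounded B z -> int_bounded B t ->
  int_bounded (2 * B ^+ 2) (x * y - z * t).
Proof.
move=> B1 [xi xB] [yi yB] [zi zB] [ti tB]; split.
  by rewrite rpredB ?rpredM.
apply: (le_trans (ler_normB _ _)); rewrite !normrM expr2.
have h (u v : R) : `|u| <= B -> `|v| <= B -> `|u| * `|v| <= B * B.
  by move=> ? ?; apply: ler_pM.
by have := h _ _ xB yB; have := h _ _ zB tB; lra.
Qed.

Lemma int_bounded_grow B x : 1 <= B -> int_bounded B x ->
  int_bounded (2 * B ^+ 2) x.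
Proof. by move=> B1 [xi xB]; split=> //; apply: (le_trans xB); rewrite expr2; nra. Qed.

(** A Hoffman-type bound that is uniform in the number of scenarios: if the
    exact homogeneous system determines v (as 0), then a violation of at most
    C Delta in the rows moves v by at most C' Delta, where C' is chosen before
    the strings, the alphabet and the rows.

    The coordinates are eliminated one by one, each of them at all strings at
    once, in the order of decreasing number of known letters.  The
    strings of two rows that contain the same variable (q, prefix) agree on the
    prefix known to q, hence carry the same variables for every coordinate that
    is left; so the combined row is again a row along
    a single string, and the list of coordinates drops by one.  One step
    replaces the coefficient bound B by 2 B^2 and the tolerance C by 2 B C,
    whatever the number of rows.  When only v is left, uniqueness provides a
    row with a positive and a row with a negative coefficient, and these
    coefficients are integers, hence at least 1 in absolute value. *)
Lemma elimination_bound (s : seq Q) (B C : R) :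
  uniq s -> sorted (relpre len geq) s -> 1 <= B -> 0 <= C ->
  exists2 C' : R, 0 <= C' &
  forall (n : nat) (T : finType) (I : finType) (om : I -> n.-tuple T)
    (a0 : I -> R) (a : I -> Q -> R),
  (forall i, int_bounded B (a0 i)) ->
  (forall i q, int_bounded B (a i q)) ->
  (forall w0 w, nonanticipative w ->
     (forall i, 0 <= form_val s (a0 i) (a i) w0 (w (om i))) -> w0 = 0) ->
  forall (v : R) d (Delta : R), 0 <= Delta -> nonanticipative d ->
    (forall i, - (C * Delta) <= form_val s (a0 i) (a i) v (d (om i))) ->
  `|v| <= C' * Delta.
Proof.
elim: s B C => [|q s IH] B C.
  move=> _ _ B1 C0; exists C => // n T I om a0 a a0B aB exact v d Delta D0 na appr.
  have witness w0 : w0 != 0 -> exists i, a0 i * w0 < 0.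
    move=> w0n; apply: contrapT => no; case/eqP: w0n.
    apply: (exact w0 (fun _ _ => 0)) => // i.
    rewrite /form_val big_nil addr0 leNgt; apply/negP => neg.
    by apply: no; exists i.
  rewrite ler_norml; apply/andP; split.
    have [i] := witness (-1) ltac:(by rewrite oppr_eq0 oner_eq0).
    rewrite mulrN1 oppr_lt0 => ai; have := appr i.
    rewrite /form_val big_nil addr0.
    have : 1 <= a0 i by rewrite -(gtr0_norm ai) norm_intr_ge1 ?gt_eqF //; case: (a0B i).
    have : 0 <= C * Delta by exact: mulr_ge0.
    move: (C * Delta) (a0 i) => *; nra.
  have [i] := witness 1 ltac:(by rewrite oner_eq0).
  rewrite mulr1 => ai; have := appr i.
  rewrite /form_val big_nil addr0.
  have : 1 <= - a0 i by rewrite -(ltr0_norm ai) norm_intr_ge1 ?lt_eqF //; case: (a0B i).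
  have : 0 <= C * Delta by exact: mulr_ge0.
    move: (C * Delta) (a0 i) => *; nra.
rewrite cons_uniq => /andP[qs us] srt B1 C0.
have srt' := path_sorted srt.
have lenq r : r \in s -> (len r <= len q)%N.
  move: srt => /= /order_path_min h rs.
  have /allP := h (fun x y z xy yz => leq_trans yz xy).
  by move=> /(_ r rs).
have B1' : 1 <= 2 * B ^+ 2 by rewrite expr2; nra.
have C0' : 0 <= 2 * B * C by rewrite mulr_ge0 // mulr_ge0 //; lra.
have [C' C'0 bound] := IH _ _ us srt' B1' C0'.
exists C' => // n T I om a0 a a0B aB exact v d Delta D0 na appr.
(* New rows are indexed by pairs of old ones.  A row without q is kept; a lower
   and an upper bound of the same variable are combined so that q cancels; every
   other pair yields the zero row. *)
pose together i j := take (len q) (om i) == take (len q) (om j).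
pose fm (S : Type) (zero : S) (keep : S) (cross : S) (ij : I * I) : S :=
  if a ij.1 q == 0 then keep else
  if [&& 0 < a ij.1 q, a ij.2 q < 0 & together ij.1 ij.2] then cross else zero.
pose b0 (ij : I * I) : R := fm _ 0 (a0 ij.1)
  (a ij.1 q * a0 ij.2 - a ij.2 q * a0 ij.1) ij.
pose b (ij : I * I) (r : Q) : R := fm _ 0 (a ij.1 r)
  (a ij.1 q * a ij.2 r - a ij.2 q * a ij.1 r) ij.
have val_cons i u w : form_val (q :: s) (a0 i) (a i) u (w (om i)) =
    form_val s (a0 i) (a i) u (w (om i)) + a i q * w (om i) q.
  by rewrite /form_val big_cons; ring.
have val_row ij u w : nonanticipative w ->
    form_val s (b0 ij) (b ij) u (w (om ij.1)) =
    fm _ 0 (form_val s (a0 ij.1) (a ij.1) u (w (om ij.1)))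
      (a ij.1 q * form_val s (a0 ij.2) (a ij.2) u (w (om ij.2))
       - a ij.2 q * form_val s (a0 ij.1) (a ij.1) u (w (om ij.1))) ij.
  move=> naw; rewrite /b0 /b /fm; case: eqP => // _; case: ifP; last first.
    by move=> _; rewrite /form_val mul0r add0r big1 // => r _; rewrite mul0r.
  case/and3P => _ _ /eqP tog.
  have -> : form_val s (a0 ij.2) (a ij.2) u (w (om ij.2)) =
            form_val s (a0 ij.2) (a ij.2) u (w (om ij.1)).
    rewrite /form_val; congr (_ + _); apply: eq_big_seq => r rs; congr (_ * _).
    apply: naw; have le := lenq r rs.
    by rewrite -(take_takel (om ij.2) le) -tog take_takel.
  rewrite /form_val !mulrDr !mulr_sumr mulrBl.
  rewrite (eq_bigr (fun r => a ij.1 q * (a ij.2 r * w (om ij.1) r)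
     - a ij.2 q * (a ij.1 r * w (om ij.1) r))); last by move=> r _; ring.
  by rewrite sumrB; ring.
have zero_bounded : int_bounded (2 * B ^+ 2) 0.
  by split; rewrite ?rpred0 // normr0; lra.
apply: (bound n T (I * I)%type (fun ij => om ij.1) b0 b _ _ _ v d Delta D0 na).
- move=> ij; rewrite /b0 /fm; case: ifP => _; first exact: int_bounded_grow.
  by case: ifP => _ //; apply: int_bounded_cross.
- move=> ij r; rewrite /b /fm; case: ifP => _; first exact: int_bounded_grow.
  by case: ifP => _ //; apply: int_bounded_cross.
- move=> w0 w naw ge0.
  pose rest i := form_val s (a0 i) (a i) w0 (w (om i)).
  (* [good o] depends on o through the prefix known to q only, hence so does the
     value that is chosen in it. *)
  pose good (o : n.-tuple T) : set R := fun x => forall i,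
     take (len q) (om i) == take (len q) o -> 0 <= rest i + a i q * x.
  have good_ex o : exists x, good o x.
    apply: solve_one_variable.
      move=> i _ ai; have := ge0 (i, i).
      by rewrite val_row // /fm /= ai eqxx.
    move=> i j /eqP io /eqP jo ai aj; have := ge0 (i, j); rewrite val_row // /fm /=.
    by rewrite (gt_eqF ai) ai aj /together io jo eqxx.
  pose w' o r := if r == q then xget 0 (good o) else w o r.
  apply: (exact w0 w').
    move=> r o o' oo'; rewrite /w'; case: eqP => [rq|_]; last exact: naw.
    by rewrite /good -rq oo'.
  move=> i; rewrite val_cons {2}/w' eqxx.
  have -> : form_val s (a0 i) (a i) w0 (w' (om i)) = rest i.
    rewrite /rest /form_val; congr (_ + _); apply: eq_big_seq => r rs.
    by rewrite /w'; case: eqP => // rq; rewrite -rq rs in qs.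
  have [x gx] := good_ex (om i).
  by have /(_ i (eqxx _)) := xgetPex 0 (ex_intro _ x gx).
- move=> ij; rewrite val_row // /fm.
  have CD : 0 <= C * Delta by exact: mulr_ge0.
  have := appr ij.1; have := appr ij.2; rewrite !val_cons => h2 h1.
  case: eqP => [z|_].
    by move: h1; rewrite z mul0r addr0; nra.
  case: ifP => [/and3P[p1 p2 /eqP tog]|_]; last by nra.
  move: h1 h2; rewrite (na q _ _ tog).
  have [_ ] := aB ij.1 q; have [_] := aB ij.2 q.
  rewrite (gtr0_norm p1) (ltr0_norm p2).
  move: (form_val _ _ _ _ _) (form_val _ _ _ _ _) (d _ _) (a ij.1 q) (a ij.2 q) p1 p2.
  move=> F2 F1 x p m p0 m0 mB pB h1 h2.
  have e1 : p * (F2 + m * x) >= p * - (C * Delta) by rewrite ler_pM2l.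
  have e2 : - m * (F1 + p * x) >= - m * - (C * Delta) by rewrite ler_pM2l ?oppr_gt0.
  have e3 : p * (C * Delta) <= B * (C * Delta) by rewrite ler_wpM2r.
  have e4 : - m * (C * Delta) <= B * (C * Delta) by rewrite ler_wpM2r.
  rewrite -!mulrA in e1 e2 e3 e4 *. lra.
Qed.
End Elimination.

(** * The linear programs as systems of rows *)

Section Scenarios.
Variables (m M k : nat).

Lemma size_scenario_prefix k' (o : scenario m M k 0) :
  size (take (k - k') o) == (k - k')%N.
Proof. by rewrite size_takel // size_tuple subn0 leq_subr. Qed.

Definition scenario_prefix k' (o : scenario m M k 0) : scenario m M k k' :=
  Tuple (size_scenario_prefix k' o).

Lemma size_scenario_pad k' (o : scenario m M k k') :
  size (o ++ nseq (k - (k - k')) [ffun=> ord0] : seq (letter m M)) == (k - 0)%N.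
Proof. by rewrite size_cat size_tuple size_nseq subn0 subnKC ?leq_subr. Qed.

Definition scenario_pad k' (o : scenario m M k k') : scenario m M k 0 :=
  Tuple (size_scenario_pad o).

Lemma scenario_padK k' : cancel (@scenario_pad k') (scenario_prefix k').
Proof.
move=> o; apply: val_inj => /=.
by rewrite -{1}(size_tuple o) take_size_cat.
Qed.

Lemma prefix_scenario_prefix k' (o : scenario m M k 0) (o' : scenario m M k k') :
  prefix o' o -> o' = scenario_prefix k' o.
Proof.
by rewrite prefixE size_tuple => /eqP e; apply: val_inj => /=; rewrite e.
Qed.

Lemma scenario_prefix_Omega (R : realType) (p : nat -> letter m M -> R) k'
    (o : scenario m M k 0) :
  o \in Omega p k 0 -> scenario_prefix k' o \in Omega p k k'.
Proof.
rewrite !inE => /forallP o_pos; apply/forallP => i.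
have le : (k - k' <= k - 0)%N by rewrite subn0 leq_subr.
have := o_pos (widen_ord le i).
by rewrite !(tnth_nth [ffun=> ord0]) /= nth_take.
Qed.

End Scenarios.

Lemma exists_small_step (R : realType) (I : finType) (slack slope : I -> R) :
  exists2 e : R, 0 < e & forall i, 0 < slack i -> e * slope i <= slack i.
Proof.
pose S := \sum_(i | 0 < slack i) `|slope i| / slack i.
have S0 : 0 <= S by apply: sumr_ge0 => i si; rewrite divr_ge0 // ltW.
have S1 : 0 < 1 + S by lra.
exists (1 + S)^-1; first by rewrite invr_gt0.
move=> i si; rewrite mulrC ler_pdivrMr // mulrC.
have : `|slope i| / slack i <= S.
  by rewrite /S (bigD1 i) //= lerDl sumr_ge0 // => j /andP[sj _]; rewrite divr_ge0 // ltW.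
by rewrite ler_pdivrMr // => h; have := ler_norm (slope i); nra.
Qed.

Section LinearPrograms.
Variables (R : realType) (m K : nat) (n_ : 'I_K -> nat).
Variables (A : 'M[nat]_(\sum_g n_ g, m)) (g : 'I_K).

(** The coordinates of a decision along one scenario string: the stock of each
    component, and the served demand of each product.  The same index set also
    numbers the constraints at a string: one for each component and one for each
    product.  Components of the groups after g have no variable in the program of
    g; they are kept as coordinates with zero coefficients, so that the index set
    does not depend on g. *)
Definition coordinate : finType := ({g' : 'I_K & 'I_(n_ g')} + 'I_m)%type.

(** The number of letters revealed when a coordinate is decided: group g' of the
    program of g knows the letters of levels g down to g'+1, and the served
    demand knows the whole string. *)
Definition known_letters (q : coordinate) : nat :=
  match q with inl j => (g - tag j)%N | inr _ => g.+1 end.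

Definition row_coef (q r : coordinate) : R :=
  match q, r with
  | inr i, inr i' => (i == i')%:R
  | inr _, inl _ => 0
  | inl j, inr i => (submxcol A (tag j) (tagged j) i)%:R
  | inl j, inl j' => - ((j' == j) && (tag j <= g)%N)%:R
  end.

Section Points.
Variable M : nat.
Implicit Types (s : lp_point R m M n_ g).
Implicit Types (q r : coordinate).

(** The three kinds of y-vectors seen from a full string: the first-stage variable
    for the group g itself, the recourse variable at the prefix of the string
    for an earlier group, and 0 for a later group, whose y is an input. *)
Definition stock s (o : scenario m M g.+1 0) (g' : 'I_K) : 'cV[R]_(n_ g') :=
  match g =P g' with
  | ReflectT e => ecast g' ('cV[R]_(n_ g')) e (lp_y s)
  | ReflectF _ => if (g' < g)%N then lp_ysc s (scenario_prefix g'.+1 o) else 0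
  end.

Lemma stock_root s o : stock s o g = lp_y s.
Proof. by rewrite /stock; case: eqP => // e; rewrite (eq_irrelevance e erefl). Qed.

Lemma stock_lt s o (g' : 'I_K) : (g' < g)%N ->
  stock s o g' = lp_ysc s (scenario_prefix g'.+1 o).
Proof.
move=> lt; rewrite /stock lt; case: eqP => // e.
by rewrite e ltnn in lt.
Qed.

Lemma stock_gt s o (g' : 'I_K) : (g < g')%N -> stock s o g' = 0.
Proof.
move=> lt; rewrite /stock ltnNge (ltnW lt); case: eqP => // e.
by rewrite e ltnn in lt.
Qed.

Definition lp_coord s o q : R :=
  match q with
  | inl j => stock s o (tag j) (tagged j) 0
  | inr i => lp_z s o i 0
  end.

Definition lhs s o q : R := \sum_r row_coef q r * lp_coord s o r.

Definition rhs (yin : forall g' : 'I_K, 'cV[R]_(n_ g')) (x : 'cV[R]_m) (o : scenario m M g.+1 0) q : R :=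
  match q with
  | inl j => if (g < tag j)%N then yin (tag j) (tagged j) 0 else 0
  | inr i => (x + scenario_demand o) i 0
  end.

Lemma lp_coord_nonanticipative s : nonanticipative known_letters (lp_coord s).
Proof.
case=> [[g' j]|i] o o' /= eq_pre; last first.
  congr (lp_z s _ i 0); apply: val_inj.
  by move: eq_pre; rewrite !take_oversize ?size_tuple ?subn0.
have [lt|gt|e] := ltngtP g' g.
- rewrite !stock_lt //; congr (lp_ysc s _ j 0); apply: val_inj => /=.
  by rewrite subSS.
- by rewrite !stock_gt.
- by move/val_inj: e j => -> j; rewrite !stock_root.
Qed.

Lemma lhs_inr s o i : lhs s o (inr i) = lp_z s o i 0.
Proof.
rewrite /lhs big_sumType /= big1 ?add0r; last by move=> j _; rewrite mul0r.
rewrite (bigD1 i) //= eqxx mul1r big1 ?addr0 // => i' /negPf ne.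
by rewrite eq_sym ne mul0r.
Qed.

Lemma lhs_inl s o (j : {g' : 'I_K & 'I_(n_ g')}) :
  lhs s o (inl j) =
  (submx_group A (tag j) *m lp_z s o) (tagged j) 0 - stock s o (tag j) (tagged j) 0.
Proof.
rewrite /lhs big_sumType /= addrC; congr (_ + _).
  by rewrite mxE; apply: eq_bigr => i _; rewrite !mxE.
rewrite (bigD1 j) //= eqxx /= big1 ?addr0; last first.
  by move=> j' /negPf ne; rewrite ne oppr0 mul0r.
case: leqP => [_|gt]; first by rewrite mulN1r.
by rewrite stock_gt // mxE !oppr0 mulr0.
Qed.

(** Each constraint of the program is one row at one full string, so that all
    of them have the shape handled by the elimination; the inputs and the
    scenario demands occur in the right-hand side only. *)
Lemma lp_feasibleP p yin x s :
  lp_feasible A p yin x s <->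
  forall o q, o \in Omega p g.+1 0 -> lhs s o q <= rhs yin x o q.
Proof.
split=> [[fz fsc fy fin] o [[g' j]|i] oO | f].
- rewrite lhs_inl /=; have [lt|gt|e] := ltngtP g' g.
  + rewrite stock_lt //.
    have pre : prefix (scenario_prefix g'.+1 o) o by exact: prefix_take.
    have := fsc g' o _ lt oO (scenario_prefix_Omega _ oO) pre j.
    by rewrite !mxE.
  + by rewrite stock_gt // [(0 : 'cV_ _) _ _]mxE subr0; exact: fin.
  + move/val_inj: e j => -> j; rewrite stock_root.
    by have := fy o oO j; rewrite !mxE.
- by rewrite lhs_inr; exact: fz.
split.
- by move=> o oO i; have := f o (inr i) oO; rewrite lhs_inr.
- move=> g' o o' lt oO o'O pre j; have := f o (inl (existT _ g' j)) oO.
  rewrite lhs_inl /= stock_lt // ltnNge (ltnW lt) /= (prefix_scenario_prefix pre).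
  by rewrite !mxE.
- move=> o oO j; have := f o (inl (existT _ g j)) oO.
  by rewrite lhs_inl /= stock_root ltnn !mxE.
- move=> g' o lt oO j; have := f o (inl (existT _ g' j)) oO.
  by rewrite lhs_inl /= stock_gt // lt [(0 : 'cV_ _) _ _]mxE subr0.
Qed.

Definition lp_move s (e : R) w : lp_point R m M n_ g :=
  LPPoint (lp_y s + e *: lp_y w)
    (fun g' u => lp_ysc s u + e *: lp_ysc w u)
    (fun o => lp_z s o + e *: lp_z w o).

Lemma lp_coord_move s e w o q : lp_coord (lp_move s e w) o q = lp_coord s o q + e * lp_coord w o q.
Proof.
case: q => [[g' j]|i] /=; last by rewrite !mxE.
have [lt|gt|eg] := ltngtP g' g.
- by rewrite !stock_lt // !mxE.
- by rewrite !stock_gt // !mxE mulr0 addr0.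
- by move/val_inj: eg j => -> j; rewrite !stock_root !mxE.
Qed.

Lemma lhs_move s e w o q : lhs (lp_move s e w) o q = lhs s o q + e * lhs w o q.
Proof.
rewrite /lhs mulr_sumr -big_split; apply: eq_bigr => r _ /=.
by rewrite lp_coord_move; ring.
Qed.

Lemma dotp_move n (u v v' : 'cV[R]_n) e :
  dotp u (v + e *: v') = dotp u v + e * dotp u v'.
Proof.
rewrite /dotp mulr_sumr -big_split; apply: eq_bigr => i _ /=.
by rewrite !mxE; ring.
Qed.

Lemma objective_move p prob h c s e w :
  lp_objective p prob h c (lp_move s e w) =
  lp_objective p prob h c s + e * lp_objective p prob h c w.
Proof.
rewrite /lp_objective /= dotp_move.
have -> : \sum_(g' < K | (g' < g)%N) \sum_(o in Omega p g.+1 g'.+1)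
      prob g.+1 g'.+1 o * dotp (submxcol h g') (lp_ysc s o + e *: lp_ysc w o) =
    (\sum_(g' < K | (g' < g)%N) \sum_(o in Omega p g.+1 g'.+1)
      prob g.+1 g'.+1 o * dotp (submxcol h g') (lp_ysc s o)) +
    e * (\sum_(g' < K | (g' < g)%N) \sum_(o in Omega p g.+1 g'.+1)
      prob g.+1 g'.+1 o * dotp (submxcol h g') (lp_ysc w o)).
  rewrite mulr_sumr -big_split; apply: eq_bigr => g' _ /=.
  rewrite mulr_sumr -big_split; apply: eq_bigr => o _ /=.
  by rewrite dotp_move; ring.
have -> : \sum_(o in Omega p g.+1 0)
      prob g.+1 0%N o * dotp c (lp_z s o + e *: lp_z w o) =
    (\sum_(o in Omega p g.+1 0) prob g.+1 0%N o * dotp c (lp_z s o)) +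
    e * (\sum_(o in Omega p g.+1 0) prob g.+1 0%N o * dotp c (lp_z w o)).
  rewrite mulr_sumr -big_split; apply: eq_bigr => o _ /=.
  by rewrite dotp_move; ring.
ring.
Qed.

(** A nonanticipative family as a point of the program.  A recourse variable is
    indexed by a prefix; any completion of the prefix to a full string gives the
    same value, and the completion by zero letters is used. *)
Definition point_of (w : scenario m M g.+1 0 -> coordinate -> R) :
    lp_point R m M n_ g :=
  LPPoint (\col_j w (scenario_pad [tuple of nseq (g.+1 - g.+1) [ffun=> ord0]])
                    (inl (existT _ g j)))
    (fun g' u => \col_j w (scenario_pad u) (inl (existT _ g' j)))
    (fun o => \col_i w o (inr i)).

Lemma lhs_point_of w o q : nonanticipative known_letters w ->
  lhs (point_of w) o q = \sum_r row_coef q r * w o r.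
Proof.
move=> naw; apply: eq_bigr => -[[g' j]|i] _; last by rewrite /= mxE.
have [lt|gt|e] := ltngtP g' g.
- congr (_ * _); rewrite /= stock_lt // mxE; apply: naw => /=.
  have /(congr1 val) /= := scenario_padK (scenario_prefix g'.+1 o).
  by rewrite subSS.
- case: q => [j'|i] /=; last by rewrite !mul0r.
  case: eqP => [<-|_] /=; last by rewrite oppr0 !mul0r.
  by rewrite leqNgt gt /= oppr0 !mul0r.
- move/val_inj: e j => -> j; congr (_ * _); rewrite /= stock_root mxE.
  by apply: naw => /=; rewrite subnn !take0.
Qed.

End Points.
End LinearPrograms.

(** * Lipschitz continuity of the first stage *)

Definition entry_bound (R : realType) (m n : nat) (A : 'M[nat]_(n, m)) : R :=
  1 + \sum_j \sum_i (A j i)%:R.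

Lemma row_coef_bounded (R : realType) (m K : nat) (n_ : 'I_K -> nat)
    (A : 'M[nat]_(\sum_g n_ g, m)) (g : 'I_K) (q r : coordinate m n_) :
  int_bounded (entry_bound R A) (row_coef R A g q r).
Proof.
have entries0 j : 0 <= \sum_i (A j i)%:R :> R by apply: sumr_ge0 => i _; exact: ler0n.
have rest0 : 0 <= \sum_j \sum_i (A j i)%:R :> R by apply: sumr_ge0.
have bool_bounded (b : bool) : `|b%:R : R| <= entry_bound R A.
  by rewrite normr_nat /entry_bound; case: b; rewrite /= ?mulr1n ?mulr0n; lra.
case: q r => [j|i] [j'|i'] /=.
- by split; rewrite ?rpredN ?rpred_nat ?normrN.
- split; first by rewrite rpred_nat.
  rewrite normr_nat mxE /entry_bound (bigD1 (tagnat.Rank (tag j) (tagged j))) //=.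
  rewrite (bigD1 i') //= -!addrA.
  have h1 : 0 <= \sum_(i < m | i != i') (A (tagnat.Rank (tag j) (tagged j)) i)%:R :> R.
    by apply: sumr_ge0 => i _; exact: ler0n.
  have h2 : 0 <= \sum_(i | i != tagnat.Rank (tag j) (tagged j)) \sum_i0 (A i i0)%:R :> R.
    by apply: sumr_ge0.
  lra.
- by split; rewrite ?rpred0 // normr0 /entry_bound; lra.
- by split; rewrite ?rpred_nat.
Qed.

(** Let d be the difference of the two optimal points, and keep for each row the
    signs with which its value at d is at least - Delta.  A direction W that is
    nonnegative for all signed rows kept can be added in a small amount to the
    first point and subtracted in a small amount from the second one: where W
    increases a row at the first point, the row exceeds Delta at d, so it has
    slack at the first point because the right-hand sides differ by at most
    Delta; the second point is symmetric.  Optimality of both points gives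
    objective 0 to W, so the first point moved along W is optimal, and
    uniqueness makes the first-stage part of W vanish.  Hence the homogeneous
    system kept determines the first stage, and d satisfies it up to Delta. *)
Lemma unique_optimal_lipschitz (R : realType) (m K : nat) (n_ : 'I_K -> nat)
    (A : 'M[nat]_(\sum_g n_ g, m)) (g : 'I_K) :
  exists2 C : R, 0 <= C &
  forall (M : nat) (p : nat -> letter m M -> R)
    (prob : forall k k' : nat, scenario m M k k' -> R)
    (h : 'cV[R]_(\sum_g n_ g)) (c : 'cV[R]_m)
    (yin1 yin2 : forall g' : 'I_K, 'cV[R]_(n_ g')) (x1 x2 : 'cV[R]_m)
    (s1 s2 : lp_point R m M n_ g) (Delta : R),
  0 <= Delta ->
  lp_unique_optimal A p prob h c yin1 x1 s1 ->
  lp_optimal A p prob h c yin2 x2 s2 ->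
  (forall g' : 'I_K, (g < g')%N ->
     forall j, `|yin2 g' j 0 - yin1 g' j 0| <= Delta) ->
  (forall i, `|x2 i 0 - x1 i 0| <= Delta) ->
  forall j, `|lp_y s2 j 0 - lp_y s1 j 0| <= C * Delta.
Proof.
pose len := @known_letters m K n_ g.
pose Q := @coordinate m K n_.
pose order := sort (relpre len geq) (enum Q).
have uniq_order : uniq order by rewrite sort_uniq enum_uniq.
have sorted_order : sorted (relpre len geq) order.
  by apply: sort_sorted => q r; exact: leq_total.
have sum_order (F : Q -> R) : \sum_(q <- order) F q = \sum_q F q.
  by rewrite big_uniq //; apply: eq_bigl => q; rewrite mem_sort mem_enum.
have bound1 : 1 <= entry_bound R A.
  by rewrite lerDl; apply: sumr_ge0 => j _; apply: sumr_ge0 => i _; exact: ler0n.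
have [C C0 elim] := elimination_bound uniq_order sorted_order bound1 ler01.
exists C => // M p prob h c yin1 yin2 x1 x2 s1 s2 Delta D0 uo1 o2 yinD xD j.
have [[f1 opt1] uniq1] := uo1; have [f2 opt2] := o2.
move/lp_feasibleP: (f1) => r1; move/lp_feasibleP: (f2) => r2.
have rhsD o q : `|rhs yin2 x2 (o : scenario m M g.+1 0) q - rhs yin1 x1 o q| <= Delta.
  case: q => [[g' j']|i] /=.
    by case: ifP => gg'; [exact: yinD | rewrite subrr normr0].
  by rewrite !mxE opprD addrACA subrr addr0.
pose d := lp_move s2 (-1) s1.
pose sgn (b : bool) : R := (-1) ^+ b.
pose active (o : scenario m M g.+1 0) q b :=
  (o \in Omega p g.+1 0) && (- Delta <= sgn b * lhs A d o q).
pose I : finType := (scenario m M g.+1 0 * option Q * bool)%type.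
(* The option None indexes two rows which say that the auxiliary scalar v is
   the coordinate j of the first stage; that coordinate is eliminated like all
   the others, so a single elimination order serves every j. *)
pose a0 (i : I) : R := if i.1.2 is None then sgn i.2 else 0.
pose target : Q := inl (existT _ g j).
pose a (i : I) (r : Q) : R :=
  if i.1.2 is Some q
  then if active i.1.1 q i.2 then sgn i.2 * row_coef R A g q r else 0
  else - (sgn i.2 * (r == target)%:R).
have val_some o q b v w : form_val order (a0 (o, Some q, b)) (a (o, Some q, b)) v w
    = if active o q b then sgn b * \sum_r row_coef R A g q r * w r else 0.
  rewrite /form_val mul0r add0r sum_order /a /=; case: ifP => _; last first.
    by rewrite big1 // => r _; rewrite mul0r.
  by rewrite mulr_sumr; apply: eq_bigr => r _; rewrite mulrA.
have val_none o b v w : form_val order (a0 (o, None, b)) (a (o, None, b)) v w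
    = sgn b * (v - w target).
  rewrite /form_val sum_order /a /= (bigD1 target) //= eqxx mulr1.
  rewrite big1 => [|r /negPf ne]; last by rewrite ne mulr0 oppr0 mul0r.
  by rewrite /a0 /=; ring.
have sgn_bounded b : int_bounded (entry_bound R A) (sgn b).
  by split; rewrite /sgn ?rpredX ?rpredN ?rpred1 // normrX normrN1 expr1n.
have zero_bounded : int_bounded (entry_bound R A) 0.
  by split; rewrite ?rpred0 // normr0; lra.
have -> : lp_y s2 j 0 - lp_y s1 j 0 = lp_y d j 0.
  by rewrite !mxE mulN1r.
have lhs_d o q : lhs A d o q = lhs A s2 o q - lhs A s1 o q.
  by rewrite lhs_move mulN1r.
apply: (elim _ _ I (fun i => i.1.1) a0 a _ _ _ _ (lp_coord d)) => //.
- by case=> [[ o [q|]] b]; rewrite /a0 /=.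
- case=> [[ o [q|]] b] r; rewrite /a /=.
    case: ifP => // _; have [ri rb] := row_coef_bounded R A g q r.
    have [si _] := sgn_bounded b; split; first exact: rpredM.
    by rewrite normrM /sgn normrX normrN1 expr1n mul1r.
  have [si sb] := sgn_bounded b; split; first by rewrite rpredN rpredM // rpred_nat.
  rewrite normrN normrM; case: eqP => _; first by rewrite normr1 mulr1.
  by rewrite normr0 mulr0; lra.
- move=> w0 w naw ge0.
  have w0E o : w0 = w o target.
    have := ge0 (o, None, false); have := ge0 (o, None, true).
    by rewrite !val_none /sgn /= expr1 expr0; lra.
  pose W := point_of w.
  have W_dir o q b : o \in Omega p g.+1 0 -> - Delta <= sgn b * lhs A d o q ->
      0 <= sgn b * lhs A W o q.
    move=> oO ok; have := ge0 (o, Some q, b).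
    by rewrite val_some /active /= oO ok /= lhs_point_of.
  (* The last index tells the second point, moved by - W, from the first one,
     moved by W. *)
  pose slack (t : scenario m M g.+1 0 * Q * bool) : R :=
    if t.2 then rhs yin2 x2 t.1.1 t.1.2 - lhs A s2 t.1.1 t.1.2
    else rhs yin1 x1 t.1.1 t.1.2 - lhs A s1 t.1.1 t.1.2.
  pose slope (t : scenario m M g.+1 0 * Q * bool) : R :=
    if t.2 then - lhs A W t.1.1 t.1.2 else lhs A W t.1.1 t.1.2.
  have [e e0 small] := exists_small_step slack slope.
  have feas1 : lp_feasible A p yin1 x1 (lp_move s1 e W).
    apply/lp_feasibleP => o q oO; rewrite lhs_move.
    have := r1 o q oO; have := r2 o q oO.
    have := rhsD o q; rewrite ler_norml => /andP[_ rD] le2 le1.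
    have [small_d|large_d] := lerP (lhs A d o q) Delta.
      have := W_dir o q true oO; rewrite /sgn expr1 !mulN1r lerN2 oppr_ge0.
      by move=> /(_ small_d) Wneg; nra.
    have := small (o, q, false); rewrite /slack /slope /= => h'.
    move: large_d; rewrite lhs_d => large_d.
    by have := h' ltac:(lra); lra.
  have feas2 : lp_feasible A p yin2 x2 (lp_move s2 (- e) W).
    apply/lp_feasibleP => o q oO; rewrite lhs_move.
    have := r1 o q oO; have := r2 o q oO.
    have := rhsD o q; rewrite ler_norml => /andP[rD _] le2 le1.
    have [large_d|small_d] := lerP (- Delta) (lhs A d o q).
      have := W_dir o q false oO; rewrite /sgn expr0 !mul1r.
      by move=> /(_ large_d) Wpos; nra.
    have := small (o, q, true); rewrite /slack /slope /= => h'.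
    move: small_d; rewrite lhs_d => small_d.
    by have := h' ltac:(lra); lra.
  have := opt1 _ feas1; have := opt2 _ feas2; rewrite !objective_move => le2 le1.
  have fW : e * lp_objective p prob h c W = 0 by lra.
  have [] := uniq1 (lp_move s1 e W).
    split=> // s' fs'; rewrite objective_move fW addr0; exact: opt1.
  move=> /(congr1 (fun y : 'cV_ _ => y j 0)); rewrite !mxE => eqy _ _.
  have /eqP : e * w0 = 0 by move: eqy; rewrite -[w _ _]/(w _ target) -w0E; lra.
  by rewrite mulf_eq0 gt_eqF //= => /eqP.
- exact: lp_coord_nonanticipative.
- case=> [[ o [q|]] b]; rewrite mul1r.
    rewrite val_some /active /=; case: andP => [[_]|_]; first by [].
    by rewrite oppr_le0.
  by rewrite val_none /= stock_root subrr mulr0 oppr_le0.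
Qed.

(** * Lead-time demands and induction over the groups *)

Lemma norm1_ge0 (R : realType) n (u : 'cV[R]_n) : 0 <= norm1 u.
Proof. exact: sumr_ge0. Qed.

Lemma norm1B_le (R : realType) n (u v : 'cV[R]_n) : norm1 (u - v) <= norm1 u + norm1 v.
Proof.
rewrite /norm1 -big_split; apply: ler_sum => i _ /=.
by rewrite !mxE; exact: ler_normB.
Qed.

Lemma entry_le_norm1 (R : realType) n (u : 'cV[R]_n) i : `|u i 0| <= norm1 u.
Proof. by rewrite /norm1 (bigD1 i) //= lerDl; exact: sumr_ge0. Qed.

Section Demand.
Variables (R : realType) (T : Type) (m : nat) (D : R -> T -> 'cV[nat]_m) (w : T).
Variables (K : nat) (L : nat -> R).

Definition demand_shift (g k : 'I_K) (t1 t2 : R) : 'cV[R]_m :=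
  demand D w (t2 - (L k.+1 - L g.+1)) t2 - demand D w (t1 - (L k.+1 - L g.+1)) t1.

Definition total_shift (g : 'I_K) (t1 t2 : R) : R :=
  \sum_(k < K | (g < k)%N) norm1 (demand_shift g k t1 t2).

Lemma total_shift_ge0 g t1 t2 : 0 <= total_shift g t1 t2.
Proof. by apply: sumr_ge0 => k _; exact: norm1_ge0. Qed.

Lemma norm1_le_total_shift (g k : 'I_K) t1 t2 : (g < k)%N ->
  norm1 (demand_shift g k t1 t2) <= total_shift g t1 t2.
Proof.
move=> lt; rewrite /total_shift (bigD1 k) //= lerDl.
by apply: sumr_ge0 => i _; exact: norm1_ge0.
Qed.

(** Seen from the time at which a later group g' fixes the stock used by g, the
    lead-time demand is the difference of two lead-time demands of g. *)
Lemma demand_shift_later (g g' k : 'I_K) t1 t2 :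
  demand_shift g' k (t1 + L g.+1 - L g'.+1) (t2 + L g.+1 - L g'.+1) =
  demand_shift g k t1 t2 - demand_shift g g' t1 t2.
Proof.
rewrite /demand_shift.
have e t : t + L g.+1 - L g'.+1 - (L k.+1 - L g'.+1) = t - (L k.+1 - L g.+1) by ring.
have e' t : t + L g.+1 - L g'.+1 = t - (L g'.+1 - L g.+1) by ring.
by rewrite !e !e'; apply/matrixP => i j; rewrite !mxE; ring.
Qed.

Lemma total_shift_later (g g' : 'I_K) t1 t2 : (g < g')%N ->
  total_shift g' (t1 + L g.+1 - L g'.+1) (t2 + L g.+1 - L g'.+1) <=
  (1 + K%:R) * total_shift g t1 t2.
Proof.
move=> lt; rewrite mulrDl mul1r.
have le_split : total_shift g' (t1 + L g.+1 - L g'.+1) (t2 + L g.+1 - L g'.+1) <=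
    \sum_(k < K | (g' < k)%N) norm1 (demand_shift g k t1 t2) +
    \sum_(k < K | (g' < k)%N) norm1 (demand_shift g g' t1 t2).
  rewrite -big_split; apply: ler_sum => k _ /=.
  by rewrite demand_shift_later; exact: norm1B_le.
apply: (le_trans le_split); apply: lerD.
  rewrite /total_shift [leLHS]big_mkcond [leRHS]big_mkcond; apply: ler_sum => k _.
  case: ifP => [lt'|_]; first by rewrite (ltn_trans lt lt').
  by case: ifP => _ //; exact: norm1_ge0.
apply: (@le_trans _ _ (\sum_(k < K) norm1 (demand_shift g g' t1 t2))).
  rewrite [leLHS]big_mkcond; apply: ler_sum => k _.
  by case: ifP => _ //; exact: norm1_ge0.
rewrite sumr_const card_ord -[X in X <= _]mulr_natl; apply: ler_wpM2l; first exact: ler0n.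
exact: norm1_le_total_shift.
Qed.

(** The input x of the program is the lead-time demand of the last group, which
    is one of the terms of the total unless g is itself the last group; in that
    case x is 0. *)
Lemma backlog_shift_le (g : 'I_K) t1 t2 i :
  `|demand D w (t2 + L g.+1 - L K) t2 i 0 - demand D w (t1 + L g.+1 - L K) t1 i 0|
  <= total_shift g t1 t2.
Proof.
have [lt|ge] := ltnP g.+1 K.
  have ltK : (K.-1 < K)%N by rewrite prednK // (leq_ltn_trans _ lt).
  pose k := Ordinal ltK.
  have ltk : (g < k)%N by rewrite /= -ltnS prednK // (leq_ltn_trans _ lt).
  apply: le_trans (norm1_le_total_shift t1 t2 ltk).
  apply: le_trans (entry_le_norm1 _ i); rewrite /demand_shift /= prednK; last first.
    by rewrite (leq_ltn_trans _ lt).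
  have e t : t - (L K - L g.+1) = t + L g.+1 - L K by ring.
  by rewrite !e [X in _ <= `|X|]mxE [(- _ : 'cV_ _) _ _]mxE.
have -> : g.+1 = K by apply/eqP; rewrite eqn_leq ge ltn_ord.
by rewrite !addrK !mxE !subrr normr0 total_shift_ge0.
Qed.

End Demand.

(** Induction on the distance of g from the last group: the inputs of the
    program of g are the stocks of later groups, which are Lipschitz already, and
    the lead-time demand of the last group. *)
Lemma policy_lipschitz (R : realType) (m K : nat) (n_ : 'I_K -> nat)
    (A : 'M[nat]_(\sum_g n_ g, m)) (N : nat) :
  exists2 kappa : R, 0 <= kappa &
  forall (T : Type) (M : nat) (p : nat -> letter m M -> R) (L : nat -> R)
    (prob : forall k k' : nat, scenario m M k k' -> R)
    (h : 'cV[R]_(\sum_g n_ g)) (c : 'cV[R]_m)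
    (D : R -> T -> 'cV[nat]_m) (w : T)
    (Y : forall g : 'I_K, R -> 'cV[R]_(n_ g)),
  is_lp_policy A p L prob h c D w Y ->
  forall g : 'I_K, (K - g <= N)%N ->
  forall j (t1 t2 : R), - L g.+1 <= t1 -> t1 < t2 ->
  `|Y g t2 j 0 - Y g t1 j 0| <= kappa * total_shift D w L g t1 t2.
Proof.
elim: N => [|N [kappa kappa0 IH]].
  exists 0 => // T M p L prob h c D w Y _ g.
  by rewrite leqn0 subn_eq0 leqNgt ltn_ord.
(* The Lipschitz constant of one program depends on the group; their sum serves
   all groups. *)
have step (g : 'I_K) : exists C : R, 0 <= C /\ _ :=
  let: ex_intro2 C C0 HC := unique_optimal_lipschitz R A g in
  ex_intro _ C (conj C0 HC).
have [C HC] := choice step.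
pose Cmax := \sum_g C g.
have C_le g : C g <= Cmax.
  rewrite /Cmax (bigD1 g) //= lerDl; apply: sumr_ge0 => g' _.
  by case: (HC g').
have Cmax0 : 0 <= Cmax by apply: sumr_ge0 => g _; case: (HC g).
have K1 : 0 <= (1 + K%:R : R) by rewrite addr_ge0 // ler0n.
exists (Cmax * (1 + kappa * (1 + K%:R))).
  by rewrite mulr_ge0 // addr_ge0 // mulr_ge0.
move=> T M p L prob h c D w Y policy g gN j t1 t2 t1L t12.
have t2L : - L g.+1 <= t2 by apply: (le_trans t1L); exact: ltW.
have [s1 uo1 ->] := policy g t1 t1L; have [s2 [ o2 _] ->] := policy g t2 t2L.
set V := total_shift D w L g t1 t2.
have V0 : 0 <= V by exact: total_shift_ge0.
have KV0 : 0 <= kappa * (1 + K%:R) * V by rewrite !mulr_ge0.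
have [Cg0 lip] := HC g.
have Delta0 : 0 <= (1 + kappa * (1 + K%:R)) * V by rewrite mulrDl mul1r addr_ge0.
apply: (le_trans (lip _ _ _ _ _ _ _ _ _ _ _ _ Delta0 uo1 o2 _ _ j)).
- move=> g' lt j'.
  have g'N : (K - g' <= N)%N.
    by rewrite -ltnS (leq_trans _ gN) // ltn_sub2l.
  have := IH T M p L prob h c D w Y policy g' g'N j'
    (t1 + L g.+1 - L g'.+1) (t2 + L g.+1 - L g'.+1) ltac:(lra) ltac:(lra).
  move=> h1; apply: (le_trans h1).
  have h2 := ler_wpM2l kappa0 (total_shift_later D w L t1 t2 lt).
  by apply: (le_trans h2); rewrite [leRHS]mulrDl mul1r mulrA lerDr.
- move=> i; apply: (le_trans (backlog_shift_le D w L g t1 t2 i)).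
  by rewrite mulrDl mul1r lerDl.
by rewrite -mulrA ler_wpM2r.
Qed.

Theorem corollary3 (R : realType) (m K : nat) (n_ : 'I_K -> nat)
    (A : 'M[nat]_(\sum_g n_ g, m))
    (A_row : forall j, exists i, A j i <> 0%N)
    (A_col : forall i, exists j, A j i <> 0%N) :
  exists kappa : R,
  forall (L : nat -> R) (h : 'cV[R]_(\sum_g n_ g)) (b : 'cV[R]_m)
    (d : measure_display) (T : measurableType d) (P : probability T R)
    (D : R -> T -> 'cV[nat]_m) (M : nat),
  L 0%N = 0 ->
  (forall k, (k < K)%N -> L k < L k.+1) ->
  (forall j, 0 < h j 0) ->
  (forall i, 0 < b i 0) ->
  compound_poisson P (- L K) D ->
  (0 < M)%N ->
  let p := @trunc_law R d T P m D L M in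
  exists2 delta : R, 0 < delta &
  forall (prob : forall k k' : nat, scenario m M k k' -> R)
    (h' : 'cV[R]_(\sum_g n_ g)) (c' : 'cV[R]_m),
  perturbation p h (cost_c A h b) delta prob h' c' ->
  forall (w : T) (Y : forall g : 'I_K, R -> 'cV[R]_(n_ g)),
  is_lp_policy A p L prob h' c' D w Y ->
  forall (j : 'I_(\sum_g n_ g)) (t1 t2 : R),
  let g := tagnat.sig1 j in
  - L g.+1 <= t1 -> t1 < t2 ->
  `|Y g t2 (tagnat.sig2 j) 0 - Y g t1 (tagnat.sig2 j) 0| <=
    kappa * \sum_(k < K | (g < k)%N)
      norm1 (demand D w (t2 - (L k.+1 - L g.+1)) t2
             - demand D w (t1 - (L k.+1 - L g.+1)) t1).
Proof.
have [kappa _ lipschitz] := policy_lipschitz R A K.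
exists kappa => L h b d T P D M _ _ _ _ _ _ p.
exists 1 => // prob h' c' _ w Y policy j t1 t2 g t1L t12.
exact: (lipschitz _ _ _ _ _ _ _ _ _ _ policy g (leq_subr _ _) _ t1 t2 t1L t12).
Qed.
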